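(* Let $p$ be a prime with $p\equiv 1\pmod 4$ and $m>1$ an integer. Then the complement $\overline{\Gamma(\mathbb{Z}_{p^m}[i])}$ of the zero-divisor graph $\Gamma(\mathbb{Z}_{p^m}[i])$ is pancyclic.
   Context: $\mathbb{Z}_n[i]=\mathbb{Z}[i]/\langle n\rangle=\{a+bi : a,b\in\mathbb{Z}_n\}$ with $i^2=-1$. For a finite commutative ring $R$ with unity, $\Gamma(R)$ has vertex set the nonzero zero-divisors of $R$, distinct $x,y$ adjacent iff $xy=0$. $\overline{G}$ is the complement graph: same vertices, distinct vertices adjacent iff not adjacent in $G$. A graph of order $N$ is pancyclic if $N\ge 3$ and it contains a cycle of length $k$ for every $3\le k\le N$. *)

(* Defs.v *)
From HB Require Import structures.
From mathcomp Require Import all_boot all_order all_algebra.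
From mathcomp Require Import ring.

Set Implicit Arguments.
Unset Strict Implicit.
Unset Printing Implicit Defensive.

Import GRing.Theory.
Local Open Scope ring_scope.

(* Z_n[i] = Z[i]/(n) in the presentation {a + b i : a, b in Z_n}, i^2 = -1;   *)
(* [Gauss a b] stands for a + b i. As 'Z_n is Z/max(n,2)Z, this is the        *)
(* intended ring for n > 1 only.                                              *)
Record gaussZ (n : nat) := Gauss { gre : 'Z_n; gim : 'Z_n }.

Section GaussianIntegersModN.
Variable n : nat.
Local Notation G := (gaussZ n).

Definition gauss_pair (z : G) : 'Z_n * 'Z_n := (gre z, gim z).
Definition pair_gauss (u : 'Z_n * 'Z_n) : G := Gauss u.1 u.2.

Lemma gauss_pairK : cancel gauss_pair pair_gauss.
Proof. by case. Qed.

HB.instance Definition _ := Finite.copy G (can_type gauss_pairK).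

Definition gadd (x y : G) := Gauss (gre x + gre y) (gim x + gim y).
Definition gopp (x : G) := Gauss (- gre x) (- gim x).
Definition gmul (x y : G) :=
  Gauss (gre x * gre y - gim x * gim y) (gre x * gim y + gim x * gre y).

Lemma gaddA : associative gadd.
Proof. by move=> [a b] [c d] [e f]; rewrite /gadd /= !addrA. Qed.
Lemma gaddC : commutative gadd.
Proof. by move=> [a b] [c d]; congr Gauss; rewrite addrC. Qed.
Lemma gadd0 : left_id (Gauss 0 0) gadd.
Proof. by move=> [a b]; rewrite /gadd /= !add0r. Qed.
Lemma gaddN : left_inverse (Gauss 0 0) gopp gadd.
Proof. by move=> [a b]; rewrite /gadd /= !addNr. Qed.

HB.instance Definition _ := GRing.isZmodule.Build G gaddA gaddC gadd0 gaddN.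

Lemma gmulA : associative gmul.
Proof. by move=> [a b] [c d] [e f]; congr Gauss => /=; ring. Qed.
Lemma gmulC : commutative gmul.
Proof. by move=> [a b] [c d]; congr Gauss => /=; ring. Qed.
Lemma gmul1 : left_id (Gauss 1 0) gmul.
Proof. by move=> [a b]; congr Gauss => /=; ring. Qed.
Lemma gmulDl : left_distributive gmul gadd.
Proof. by move=> [a b] [c d] [e f]; congr Gauss => /=; ring. Qed.
Lemma gone_neq0 : Gauss 1 0 != 0 :> G.
Proof. by apply/eqP => -[]. Qed.

HB.instance Definition _ :=
  GRing.Zmodule_isComNzRing.Build G gmulA gmulC gmul1 gmulDl gone_neq0.

Lemma gauss_iE : Gauss 0 1 * Gauss 0 1 = -1 :> G.
Proof. by congr Gauss => /=; ring. Qed.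

Lemma gaussE (a b : 'Z_n) : Gauss a b = Gauss a 0 + Gauss b 0 * Gauss 0 1.
Proof. by congr Gauss => /=; ring. Qed.

End GaussianIntegersModN.

Record sgraph := SGraph {
  vertex :> finType;
  adj : rel vertex;
  adj_sym : symmetric adj;
  adj_irrefl : irreflexive adj }.

Section Complement.
Variable G : sgraph.

Definition compl_adj : rel G := [rel x y | (x != y) && ~~ adj x y].

Lemma compl_adj_sym : symmetric compl_adj.
Proof. by move=> x y; rewrite /compl_adj /= eq_sym adj_sym. Qed.
Lemma compl_adj_irrefl : irreflexive compl_adj.
Proof. by move=> x; rewrite /compl_adj /= eqxx. Qed.

Definition compl_graph : sgraph := SGraph compl_adj_sym compl_adj_irrefl.

End Complement.

(* On a simple graph, duplicate-free cyclic sequences of k >= 3 vertices are  *)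
(* the cycles of length k; [ucycle] also accepts shorter sequences, which the *)
(* bound 3 <= k excludes.                                                     *)
Definition has_cycle (G : sgraph) (k : nat) : Prop :=
  exists c : seq G, size c = k /\ ucycle (@adj G) c.

Definition pancyclic (G : sgraph) : Prop :=
  (3 <= #|G|)%N /\ forall k : nat, (3 <= k <= #|G|)%N -> has_cycle G k.

Section ZeroDivisorGraph.
Variable R : finComNzRingType.

Definition zero_divisor (x : R) : bool := [exists y, (y != 0) && (x * y == 0)].

Definition zd_vertex : finType := {x : R | (x != 0) && zero_divisor x}.

Definition zd_adj : rel zd_vertex :=
  [rel x y | (x != y) && (val x * val y == 0)].

Lemma zd_adj_sym : symmetric zd_adj.
Proof. by move=> x y; rewrite /zd_adj /= eq_sym mulrC. Qed.
Lemma zd_adj_irrefl : irreflexive zd_adj.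
Proof. by move=> x; rewrite /zd_adj /= eqxx. Qed.

Definition zero_divisor_graph : sgraph := SGraph zd_adj_sym zd_adj_irrefl.

End ZeroDivisorGraph.

(* Main.v *)
Require Import Defs.
From HB Require Import structures.
From mathcomp Require Import all_boot all_order all_algebra.
From mathcomp Require Import cyclic.
From mathcomp Require Import zify ring.

(* With j ^ 2 = -1 in S = Z/p^m, the evaluations f, g at i = j and i = -j
   identify Z_{p^m}[i] with S * S. In the complement graph the vertices with f a
   unit form a clique K, completely joined to the set D of vertices with f and g
   nonunits and f nonzero; likewise the vertices with g a unit form a clique L,
   completely joined to the set E of vertices with f = 0 and g a nonunit. Adding
   the idempotent (1, 0) embeds D properly into K, and adding (0, 1) embeds E
   properly into L, so paths of every length with ends in the clique arise by
   interleaving. The vertices (1, w) and (-1, w) with w = p^(m-1) are joined to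
   all of L, which links a path through K, D and one through L, E to a cycle.
   The element w detects units: s is a unit iff s * w is nonzero. *)

Set Implicit Arguments.
Unset Strict Implicit.
Unset Printing Implicit Defensive.

Import GRing.Theory.

(** * Cycles in a graph covered by two cliques with attached sets *)

Section CliquePaths.
Variable G : sgraph.
Implicit Types (K D L E : {set G}) (x y : G) (s t : seq G).

Definition clique K := {in K &, forall x y, x != y -> adj x y}.
Definition complete_to K D := {in K & D, forall x y, adj x y}.

(* Inserts the elements of t in front of the first elements of s; surplus
   elements of t are dropped. *)
Fixpoint weave s t : seq G :=
  match s, t with
  | y :: s', z :: t' => z :: y :: weave s' t'
  | _, _ => s
  end.

Lemma perm_weave s t : size t <= size s -> perm_eq (weave s t) (s ++ t).
Proof.
elim: s t => [|y s IHs] [|z t] //= le_ts; first by rewrite cats0.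
rewrite -[_ :: s ++ _]/((y :: s) ++ z :: t) perm_sym.
rewrite (perm_catCA (y :: s) [:: z] t) /= !perm_cons perm_sym.
exact: IHs.
Qed.

Lemma last_weave x s t : last x (weave s t) = last x s.
Proof. by elim: s x t => [|y s IHs] x [|z t] //=. Qed.

(** Every inserted element of [t] lands between two consecutive elements of [x :: s], so the path
    uses only edges inside [K] and edges between [K] and [D]. *)
Lemma path_weave K D x s t : clique K -> complete_to K D ->
  uniq (x :: s) -> {subset x :: s <= K} -> {subset t <= D} ->
  path (@adj G) x (weave s t).
Proof.
move=> clK cKD; elim: s x t => [|y s IHs] x t //.
rewrite cons_uniq inE negb_or => /andP[/andP[neq_xy _] uniq_ys] sK tD.
have xK : x \in K by apply: sK; rewrite mem_head.
have ysK : {subset y :: s <= K} by move=> u us; apply: sK; rewrite inE us orbT.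
have yK : y \in K by apply: ysK; rewrite mem_head.
case: t tD => [|z t] tD /=.
  rewrite clK //=.
  by have := IHs y [::] uniq_ys ysK; case: (s) => [|? ?]; apply.
have zD : z \in D by apply: tD; rewrite mem_head.
rewrite cKD //= adj_sym cKD //=; apply: IHs => // u ut.
by apply: tD; rewrite inE ut orbT.
Qed.

(** Vertices of [K] are used first, and [D] contributes only once [K] is exhausted. A path through
    all of [K] has [#|K| - 1] gaps, which is room for all of [D] because [#|D| < #|K|]. *)
Lemma clique_join_path K D x y k : clique K -> complete_to K D ->
    [disjoint K & D] -> #|D| < #|K| ->
    x \in K -> y \in K -> x != y -> 2 <= k <= #|K| + #|D| ->
  exists s, [/\ path (@adj G) x s, last x s = y, uniq (x :: s),
                size (x :: s) = k & {subset x :: s <= K :|: D}].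
Proof.
move=> clK cKD dKD ltDK xK yK neq_xy /andP[k_ge2 k_le].
(* The ends [x] and [y] account for the 2. Here [take] saturates for large [k]; below, [k - #|K|]
   truncates to 0 for small [k]. *)
pose s := rcons (take (k - 2) (enum (K :\ x :\ y))) y.
pose t := take (k - #|K|) (enum D).
have cardK : #|K| = #|K :\ x :\ y|.+2.
  by rewrite (cardsD1 x) xK (cardsD1 y) !inE eq_sym neq_xy yK.
have sizes : size s = (minn (k - 2) (#|K| - 2)).+1.
  by rewrite size_rcons size_take_min -cardE cardK; congr (minn _ _).+1; lia.
have sizet : size t = k - #|K|.
  by rewrite size_takel // -cardE leq_subLR.
have mem_s u : u \in take (k - 2) (enum (K :\ x :\ y)) ->
    [&& u != y, u != x & u \in K].
  by move/mem_take; rewrite mem_enum !inE.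
have uniq_xs : uniq (x :: s).
  rewrite /= mem_rcons inE negb_or neq_xy rcons_uniq take_uniq ?enum_uniq //=.
  rewrite andbT; apply/andP; split.
    by apply/negP => /mem_s; rewrite eqxx andbF.
  by apply/negP => /mem_s; rewrite eqxx.
have sK : {subset x :: s <= K}.
  move=> u; rewrite inE mem_rcons inE => /or3P[/eqP->|/eqP->|/mem_s/and3P[]] //.
have tD : {subset t <= D} by move=> u /mem_take; rewrite mem_enum.
have le_ts : size t <= size s by rewrite sizet sizes; lia.
have Pst : perm_eq (x :: weave s t) ((x :: s) ++ t).
  by rewrite cat_cons perm_cons perm_weave.
exists (weave s t); split.
- exact: path_weave sK tD.
- by rewrite last_weave last_rcons.
- rewrite (perm_uniq Pst) cat_uniq uniq_xs take_uniq ?enum_uniq // andbT.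
  apply/hasPn => u /tD uD; apply/negP => /sK uK.
  by have := disjointFr dKD uK; rewrite uD.
- by rewrite (perm_size Pst) size_cat /= sizes sizet; lia.
- move=> u; rewrite (perm_mem Pst) mem_cat !inE.
  by case/orP => [/sK-> | /tD->]; rewrite ?orbT.
Qed.

(** Short cycles close a path in [K :|: D] by the edge between its ends [x] and [y]. Longer ones
    take a path through all of [K :|: D] and return from [y] to [x] through [L :|: E]. *)
Lemma pancyclic_two_cliques K D L E x y :
    clique K -> complete_to K D -> clique L -> complete_to L E ->
    [disjoint K & D] -> [disjoint L & E] -> [disjoint K :|: D & L :|: E] ->
    (K :|: D) :|: (L :|: E) = setT ->
    #|D| < #|K| -> #|E| < #|L| -> 1 < #|L| ->
    x \in K -> y \in K -> x != y ->
    {in L, forall z, adj x z} -> {in L, forall z, adj y z} ->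
  pancyclic G.
Proof.
move=> clK cKD clL cLE dKD dLE dKL cover ltDK ltEL L_gt1 xK yK neq_xy xL yL.
have cardUI (A B : {set G}) : [disjoint A & B] -> #|A :|: B| = #|A| + #|B| :> nat.
  by move=> dAB; apply/eqP; rewrite (leq_card_setU A B).2.
have cardG : #|G| = #|K| + #|D| + (#|L| + #|E|).
  by rewrite -cardsT -cover !cardUI.
have K_gt1 : 1 < #|K| by apply/card_gt1P; exists x, y; split.
have [b [b' [bL b'L neq_b]]] := card_gt1P L_gt1.
split=> [|k /andP[k_ge3 k_le]]; first by rewrite cardG; lia.
case: (leqP k (#|K| + #|D|)) => [le_k | gt_k].
  have [|s [xs lasts uniqs sizes _]] :=
    clique_join_path clK cKD dKD ltDK xK yK neq_xy (k := k).
    by rewrite le_k andbT; lia.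
  exists (x :: s); split => //; apply/andP; split => //=.
  by rewrite rcons_path xs lasts clK // eq_sym.
have [|s [xs lasts uniqs sizes sKD]] :=
  clique_join_path clK cKD dKD ltDK xK yK neq_xy (k := #|K| + #|D|).
  by rewrite leqnn andbT; lia.
have nKD u : u \in L :|: E -> u \notin x :: s.
  by move=> uLE; apply/negP => /sKD uKD; have := disjointFr dKL uKD; rewrite uLE.
(* A path in [L :|: E] with distinct ends has at least two vertices, so the detour through a single
   vertex [b] is treated apart. *)
case: (leqP k (#|K| + #|D|).+1) => [le_k | gt_k1].
  exists (x :: rcons s b); split.
    by rewrite /= size_rcons -[_.+1]/(size (x :: s)).+1; lia.
  apply/andP; split.
    by rewrite /= !rcons_path xs last_rcons lasts yL //= adj_sym xL.
  by rewrite -rcons_cons rcons_uniq uniqs nKD // inE bL.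
have [|s' [bs lasts' uniqs' sizes' sLE]] :=
  clique_join_path clL cLE dLE ltEL bL b'L neq_b (k := k - (#|K| + #|D|)).
  by lia.
exists (x :: s ++ b :: s'); split.
  by rewrite -cat_cons size_cat sizes sizes'; lia.
apply/andP; split.
  rewrite /= rcons_path cat_path last_cat xs lasts /= yL //= bs lasts'.
  by rewrite adj_sym xL.
rewrite -cat_cons cat_uniq uniqs uniqs' andbT.
by apply/hasPn => u /sLE /nKD.
Qed.

End CliquePaths.

(** * The complement graph for a ring that splits as a product of two copies of [S] *)

Section SplitRing.
Local Open Scope ring_scope.
Variables (R : finComNzRingType) (S : comUnitRingType).
Variables (f g : {rmorphism R -> S}) (w : S).
Hypothesis fg_inj : forall r r', f r = f r' -> g r = g r' -> r = r'.
Hypothesis fg_surj : forall a b, exists r, f r = a /\ g r = b.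
Hypothesis unitw : forall s : S, (s \is a GRing.unit) = (s * w != 0).
Hypothesis ww0 : w * w = 0.
Hypothesis unit2 : (2 : S) \is a GRing.unit.

Local Notation V := (compl_graph (zero_divisor_graph R)).
Local Notation U s := (s \is a GRing.unit).
Implicit Types x y z : zd_vertex R.

Let w_neq0 : w != 0. Proof. by rewrite -[w]mul1r -unitw unitr1. Qed.
Let unit_w : ~~ U w. Proof. by rewrite unitw ww0 eqxx. Qed.

(** The nonunits are exactly the annihilator of [w], so adding one leaves [s * w] unchanged. *)
Lemma unitDl_nonunit (s t : S) : ~~ U t -> U (s + t) = U s.
Proof. by rewrite !unitw negbK mulrDl => /eqP->; rewrite addr0. Qed.

Lemma unit_mul_neq0 (s t : S) : U s -> t != 0 -> s * t != 0.
Proof. by move=> Us; apply: contraNneq => st0; rewrite -(mulKr Us t) st0 mulr0. Qed.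

(** A nonunit coordinate is annihilated by [w], so (w, 0) or (0, w) is a nonzero annihilator of (a,
    b). *)
Lemma exists_zd_vertex a b : (a != 0) || (b != 0) -> ~~ (U a && U b) ->
  exists x, f (val x) = a /\ g (val x) = b.
Proof.
move=> ab0 Uab; have [r [fr gr]] := fg_surj a b.
suff Pr : (r != 0) && zero_divisor r by exists (Sub r Pr); rewrite SubK.
apply/andP; split.
  by apply: contraTneq ab0 => r0; rewrite -fr -gr r0 !rmorph0 eqxx.
have zd (c d : S) : (c != 0) || (d != 0) -> a * c = 0 -> b * d = 0 -> zero_divisor r.
  move=> cd0 ac0 bd0; have [t [ft gt]] := fg_surj c d.
  apply/existsP; exists t; apply/andP; split.
    by apply: contraTneq cd0 => t0; rewrite -ft -gt t0 !rmorph0 eqxx.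
  by apply/eqP/fg_inj; rewrite rmorphM rmorph0 ?fr ?gr ?ft ?gt.
move: Uab; rewrite negb_and !unitw !negbK => /orP[]/eqP.
  by move=> aw0; apply: (zd w 0); rewrite ?w_neq0 ?mulr0.
by move=> bw0; apply: (zd 0 w); rewrite ?w_neq0 ?mulr0 ?orbT.
Qed.

Lemma zd_vertex_nonunit x : ~~ (U (f (val x)) && U (g (val x))).
Proof.
apply/negP => /andP[Uf Ug].
have /andP[_ /existsP[y /andP[y0 /eqP xy0]]] := valP x.
case/negP: y0; apply/eqP/fg_inj; rewrite rmorph0.
  by apply: (mulrI Uf); rewrite -rmorphM xy0 rmorph0 mulr0.
by apply: (mulrI Ug); rewrite -rmorphM xy0 rmorph0 mulr0.
Qed.

Lemma zd_vertex_neq0 x : (f (val x) != 0) || (g (val x) != 0).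
Proof.
rewrite -negb_and; apply/negP => /andP[/eqP fx0 /eqP gx0].
have /andP[/eqP x_neq0 _] := valP x.
by apply: x_neq0; apply: fg_inj; rewrite rmorph0.
Qed.

Lemma compl_zd_adjf x y : x != y -> f (val x) * f (val y) != 0 -> @adj V x y.
Proof.
move=> neq_xy fxy0.
apply/andP; split=> //=; rewrite negb_and; apply/orP; right.
by apply: contraNneq fxy0 => xy0; rewrite -rmorphM xy0 rmorph0.
Qed.

Lemma compl_zd_adjg x y : x != y -> g (val x) * g (val y) != 0 -> @adj V x y.
Proof.
move=> neq_xy gxy0.
apply/andP; split=> //=; rewrite negb_and; apply/orP; right.
by apply: contraNneq gxy0 => xy0; rewrite -rmorphM xy0 rmorph0.
Qed.

(** Translation by [r] is injective from [A] into [B], and [z] lies outside its image. *)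
Lemma card_shift_lt (A B : {set zd_vertex R}) r :
    {in A, forall x, exists2 y, y \in B & val y = val x + r} ->
    (exists2 z, z \in B & {in A, forall x, val z != val x + r}) ->
  (#|A| < #|B|)%N.
Proof.
move=> shiftAB [z zB zA].
(* The sum need not be a vertex in general; the default [x] is never reached on [A]. *)
pose h x := insubd x (val x + r).
have hE x : x \in A -> val (h x) = val x + r /\ h x \in B.
  move=> /shiftAB[y yB yE]; rewrite /h -yE.
  have -> : insubd x (val y) = y by apply: val_inj; rewrite val_insubd (valP y).
  by [].
have injh : {in A &, injective h}.
  move=> x x' xA x'A /(congr1 val); rewrite (hE _ xA).1 (hE _ x'A).1.
  by move/addIr/val_inj.
rewrite -(card_in_imset injh); apply: proper_card; apply/properP; split.
  by apply/subsetP => _ /imsetP[x xA ->]; case: (hE x xA).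
exists z => //; apply/imsetP => -[x xA zE].
by have := zA x xA; rewrite zE (hE x xA).1 eqxx.
Qed.

Lemma pancyclic_compl_zero_divisor_graph : pancyclic V.
Proof.
pose K : {set V} := [set x | U (f (val x))].
pose D : {set V} :=
  [set x | [&& ~~ U (f (val x)), ~~ U (g (val x)) & f (val x) != 0]].
pose L : {set V} := [set x | ~~ U (f (val x)) && U (g (val x))].
pose E : {set V} := [set x | ~~ U (g (val x)) && (f (val x) == 0)].
have neq_in (A B : {set V}) : [disjoint A & B] ->
    {in A & B, forall x y : V, x != y}.
  move=> dAB x y xA yB; apply: contraTneq xA => ->.
  by rewrite (disjointFl dAB yB).
have dKD : [disjoint K & D].
  by rewrite disjoint_subset; apply/subsetP => x; rewrite !inE => ->.
have dLE : [disjoint L & E].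
  by rewrite disjoint_subset; apply/subsetP => x; rewrite !inE => /andP[_ ->].
have dKL : [disjoint K & L].
  by rewrite disjoint_subset; apply/subsetP => x; rewrite !inE => ->.
have dKDLE : [disjoint K :|: D & L :|: E].
  rewrite disjoint_subset; apply/subsetP => x; rewrite !inE.
  case/orP => [Uf | /and3P[/negPf-> /negPf-> /negPf->]] //.
  rewrite Uf /=; apply/negP => /andP[_ /eqP f0].
  by move: Uf; rewrite f0 unitr0.
have Uopp1 : U (-1 : S) by rewrite unitrN1.
have neq1 : (1 : S) != -1.
  rewrite -subr_eq0 opprK -[1 + 1]/(2 : S).
  by apply: contraTneq unit2 => ->; rewrite unitr0.
(* The coordinate [w] is a nonunit, as a vertex with first coordinate a unit requires, yet its
   product with any unit is nonzero. *)
have [||x [fx gx]] := @exists_zd_vertex 1 w.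
- by rewrite oner_eq0.
- by rewrite (negPf unit_w) andbF.
have [||y [fy gy]] := @exists_zd_vertex (-1) w.
- by rewrite oppr_eq0 oner_eq0.
- by rewrite (negPf unit_w) andbF.
(* The vertices (0, 1) and (0, -1) show that [L] has two elements; the second is also missed by the
   shift of [E] into [L]. Likewise (-1, 0) is missed by the shift of [D] into [K]. *)
have [||b [fb gb]] := @exists_zd_vertex 0 1.
- by rewrite oner_eq0 orbT.
- by rewrite unitr0.
have [||b' [fb' gb']] := @exists_zd_vertex 0 (-1).
- by rewrite oppr_eq0 oner_eq0 orbT.
- by rewrite unitr0.
have [||a' [fa' ga']] := @exists_zd_vertex (-1) 0.
- by rewrite oppr_eq0 oner_eq0.
- by rewrite unitr0 andbF.
have xK : x \in K by rewrite inE fx unitr1.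
have yK : y \in K by rewrite inE fy.
have bL : b \in L by rewrite inE fb gb unitr0 unitr1.
have b'L : b' \in L by rewrite inE fb' gb' unitr0.
(* Equality would give [s = -2], which is a unit. *)
have nonunit_shift (s : S) : ~~ U s -> -1 != s + 1.
  move=> Us; apply: contraNneq Us => /esym s1.
  by rewrite -(addrK 1 s) s1 -opprD unitrN.
have joinL z : z \in K -> g (val z) = w -> {in L, forall l, @adj V z l}.
  move=> zK gz l lL; apply: compl_zd_adjg; first exact: neq_in dKL _ _ zK lL.
  by rewrite gz mulrC unit_mul_neq0 //; move: lL; rewrite inE => /andP[].
apply: (@pancyclic_two_cliques V K D L E x y) => //.
- move=> u v; rewrite !inE => Uu Uv neq_uv; apply: compl_zd_adjf => //.
  by rewrite unit_mul_neq0 //; apply: contraTneq Uv => ->; rewrite unitr0.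
- move=> u v uK vD; apply: compl_zd_adjf; first exact: neq_in dKD _ _ uK vD.
  move: uK vD; rewrite !inE => Uu /and3P[_ _ v0]; exact: unit_mul_neq0.
- move=> u v; rewrite !inE => /andP[_ Uu] /andP[_ Uv] neq_uv.
  apply: compl_zd_adjg => //.
  by rewrite unit_mul_neq0 //; apply: contraTneq Uv => ->; rewrite unitr0.
- move=> u v uL vE; apply: compl_zd_adjg; first exact: neq_in dLE _ _ uL vE.
  move: uL vE; rewrite !inE => /andP[_ Uu] /andP[_ v0]; apply: unit_mul_neq0 => //.
  by have := zd_vertex_neq0 v; rewrite v0.
- apply/setP => z; rewrite !inE.
  have := zd_vertex_nonunit z.
  case: (U (f _)) (U (g _)) => [] [] //= _.
  by case: eqP.
- have [e [fe ge]] := fg_surj 1 0.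
  apply: (card_shift_lt (r := e)) => [z|].
    rewrite inE => /and3P[Ufz Ugz fz0].
    have Uf1 : U (f (val z) + 1) by rewrite addrC unitDl_nonunit ?unitr1.
    have [||u [fu gu]] := @exists_zd_vertex (f (val z) + 1) (g (val z)).
    + by apply/orP; left; apply: contraTneq Uf1 => ->; rewrite unitr0.
    + by rewrite (negPf Ugz) andbF.
    exists u; first by rewrite inE fu.
    by apply: fg_inj; rewrite rmorphD ?fe ?ge ?addr0.
  exists a' => [|z]; first by rewrite inE fa'.
  rewrite inE => /and3P[Ufz _ _]; apply: contraNneq (nonunit_shift _ Ufz) => zE.
  by rewrite -fa' zE rmorphD fe.
- have [e [fe ge]] := fg_surj 0 1.
  apply: (card_shift_lt (r := e)) => [z|].
    rewrite inE => /andP[Ugz /eqP fz0].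
    have Ug1 : U (g (val z) + 1) by rewrite addrC unitDl_nonunit ?unitr1.
    have [||u [fu gu]] := @exists_zd_vertex 0 (g (val z) + 1).
    + by apply/orP; right; apply: contraTneq Ug1 => ->; rewrite unitr0.
    + by rewrite unitr0.
    exists u; first by rewrite inE fu gu unitr0.
    by apply: fg_inj; rewrite rmorphD ?fe ?ge ?fz0 ?addr0.
  exists b' => [|z]; first by [].
  rewrite inE => /andP[Ugz _]; apply: contraNneq (nonunit_shift _ Ugz) => zE.
  by rewrite -gb' zE rmorphD ge.
- apply/card_gt1P; exists b, b'; split => //.
  by apply: contraNneq neq1 => bb'; rewrite -gb' -bb' gb.
- by apply: contraNneq neq1 => xy; rewrite -fy -xy fx.
- exact: joinL.
- exact: joinL.
Qed.

End SplitRing.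

(** * Square roots of -1 modulo a prime power *)

Lemma expn_prime_power_mod p n x : prime p -> x ^ (p ^ n) = x %[mod p].
Proof.
move=> p_pr; elim: n => [|n IHn]; first by rewrite expn0 expn1.
by rewrite expnS mulnC expnM fermat_little.
Qed.

(** In the field ['F_p] at most (p - 1) / 2 elements are roots of unity of that order, fewer than
    the p - 1 nonzero elements. *)
Lemma exists_half_power_neq1 p : prime p -> odd p ->
  exists2 x, coprime x p & x ^ p.-1./2 <> 1 %[mod p].
Proof.
move=> p_pr p_odd; have p_gt1 := prime_gt1 p_pr.
have half_gt0 : 0 < p.-1./2 by move: p_odd p_gt1; case: (p) => [|[|[|n]]].
have [/forallP all1 | ] :=
  boolP [forall z : 'F_p, (z != 0%R) ==> (z ^+ p.-1./2 == 1)%R].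
  have := @max_unity_roots _ p.-1./2 (enum (predC1 (0%R : 'F_p))) half_gt0.
  rewrite enum_uniq -cardE cardC1 card_Fp // => /(_ _ isT) max_roots.
  suff /max_roots : all (p.-1./2).-unity_root%R (enum (predC1 (0%R : 'F_p))) by lia.
  apply/allP => z; rewrite mem_enum unity_rootE => z0.
  by have /implyP := all1 z; apply.
rewrite negb_forall => /existsP[z]; rewrite negb_imply => /andP[z0 z1].
exists (nat_of_ord z).
  rewrite coprime_sym prime_coprime //; apply: contra z0 => pz.
  by rewrite -[z]natr_Zp -(dvdn_pcharf (pchar_Fp p_pr)).
move=> zE; case/eqP: z1; rewrite -[z]natr_Zp -natrX.
by rewrite -(Fp_nat_mod p_pr) zE (Fp_nat_mod p_pr).
Qed.

(* For x a quadratic non-residue mod p, x ^ (phi (p ^ m) / 2) is a square root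
   of 1 mod p ^ m that is not 1 mod p, hence it is -1. *)
Lemma exists_sqrtN1_mod p m : prime p -> p = 1 %[mod 4] -> 0 < m ->
  exists j, p ^ m %| (j ^ 2).+1.
Proof.
move=> p_pr p4 m_gt0; have p_gt1 := prime_gt1 p_pr.
have [k pE] : exists k, p = 4 * k + 1 by exists (p %/ 4); lia.
have p_odd : odd p by lia.
have [x co_xp x1] := exists_half_power_neq1 p_pr p_odd.
have x_gt0 : 0 < x by case: (x) co_xp => //; rewrite /coprime gcd0n; lia.
(* Since [p = 4 * k + 1], this exponent is phi (p ^ m) / 4, and [z] is the square of the witness. *)
exists (x ^ (k * p ^ m.-1)); rewrite -expnM.
set z := x ^ _.
have zz1 : z ^ 2 = 1 %[mod p ^ m].
  rewrite -(Euler_exp_totient (coprimeXr m co_xp)) totient_pfactor //.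
  rewrite /z -expnM (_ : p.-1 = 4 * k); last by lia.
  by congr (x ^ _ %% _); move: (p ^ _) => c; lia.
have z_gt0 : 0 < z by rewrite expn_gt0 x_gt0.
(* Modulo [p], raising to the power [p ^ m.-1] changes nothing, so [z] is congruent to
   [x ^ p.-1./2]. *)
have zNp : ~~ (p %| z - 1).
  rewrite -eqn_mod_dvd //; apply/eqP => z1; case: x1; rewrite -z1.
  rewrite (_ : z = (x ^ p.-1./2) ^ (p ^ m.-1)) ?expn_prime_power_mod //.
  rewrite -expnM /z (_ : p.-1./2 = 2 * k); last by lia.
  by congr (x ^ _); move: (p ^ _) => c; lia.
have : p ^ m %| (z - 1) * z.+1.
  rewrite (_ : (z - 1) * z.+1 = z ^ 2 - 1); last by rewrite -[1 in RHS](exp1n 2) subn_sqr addn1.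
  by rewrite -eqn_mod_dvd; [apply/eqP | rewrite expn_gt0 z_gt0].
(* As [p] does not divide [z - 1], the whole of [p ^ m] must divide [z.+1]. *)
by rewrite Gauss_dvdr // coprimeXl // prime_coprime.
Qed.

Local Open Scope ring_scope.

(** * Zero and units in the residue rings *)

Lemma Zp_nat_eq0 n k : (1 < n)%N -> (k%:R == 0 :> 'Z_n) = (n %| k)%N.
Proof. by move=> n_gt1; rewrite -val_eqE /= val_Zp_nat. Qed.

(** Both sides say that [p] does not divide a representative of [s]: cancelling [p ^ m.-1] turns
    divisibility by [p ^ m] into divisibility by [p]. *)
Lemma unit_Zp_primeX p m (s : 'Z_(p ^ m)) : prime p -> (0 < m)%N ->
  (s \is a GRing.unit) = (s * (p ^ m.-1)%:R != 0).
Proof.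
move=> p_pr m_gt0.
have pm_gt1 : (1 < p ^ m)%N by rewrite -(expn0 p) ltn_exp2l ?prime_gt1.
rewrite -[s]natr_Zp unitZpE // -natrM Zp_nat_eq0 //; move: (nat_of_ord s) => k.
rewrite -{2}(prednK m_gt0) expnS dvdn_pmul2r ?expn_gt0 ?prime_gt0 //.
by rewrite coprime_pexpl // prime_coprime.
Qed.

(** * Evaluation of Gaussian integers at a square root of -1 *)

Section GaussEval.
Variable n : nat.

(* The proof argument makes the ring morphism instances below inferable. *)
Definition gauss_eval (j : 'Z_n) of j * j = -1 :=
  fun z : gaussZ n => gre z + gim z * j.

Variables (j : 'Z_n) (jj : j * j = -1).

Fact gauss_eval_zmod : zmod_morphism (gauss_eval jj).
Proof. by move=> x y; rewrite /gauss_eval /=; ring. Qed.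

Fact gauss_eval_monoid : monoid_morphism (gauss_eval jj).
Proof.
split=> [|x y]; rewrite /gauss_eval /=; first by ring.
(* This form isolates [j * j], so that [jj] can be applied between two ring identities. *)
transitivity (gre x * gre y + gim x * gim y * (j * j)
  + (gre x * gim y + gim x * gre y) * j); last by ring.
by rewrite jj; ring.
Qed.

HB.instance Definition _ :=
  GRing.isZmodMorphism.Build (gaussZ n) 'Z_n (gauss_eval jj) gauss_eval_zmod.
HB.instance Definition _ :=
  GRing.isMonoidMorphism.Build (gaussZ n) 'Z_n (gauss_eval jj) gauss_eval_monoid.

End GaussEval.

Local Close Scope ring_scope.

Theorem theorem4p2 (p m : nat) (hp : prime p) (hp4 : p = 1 %[mod 4]) (hm : 1 < m) :
  pancyclic (compl_graph (zero_divisor_graph (gaussZ (p ^ m)))).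
Proof.
have m_gt0 : 0 < m by lia.
have pm_gt1 : 1 < p ^ m by rewrite -(expn0 p) ltn_exp2l ?prime_gt1.
have [k kN1] := exists_sqrtN1_mod hp hp4 m_gt0.
pose j : 'Z_(p ^ m) := k%:R%R.
have jj : (j * j = -1)%R.
  by apply/eqP; rewrite -addr_eq0 -natrM natr1 Zp_nat_eq0 //.
have NjNj : (- j * - j = -1)%R by rewrite mulrNN.
have unit2 : (2%:R : 'Z_(p ^ m))%R \is a GRing.unit.
  by rewrite unitZpE // coprimeXl // coprime_sym prime_coprime //; lia.
(* The two evaluations of a + b i have sum 2 a and difference 2 b j, so injectivity cancels 2 and 2
   j. *)
have unit2j : (2%:R * j : 'Z_(p ^ m))%R \is a GRing.unit.
  rewrite unitrM unit2; apply/unitrP; exists (- j)%R.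
  by rewrite mulNr mulrN jj opprK.
pose f : {rmorphism gaussZ (p ^ m) -> 'Z_(p ^ m)} := gauss_eval jj.
pose g : {rmorphism gaussZ (p ^ m) -> 'Z_(p ^ m)} := gauss_eval NjNj.
have fE a b : (f (Gauss a b) = a + b * j)%R by [].
have gE a b : (g (Gauss a b) = a - b * j)%R by rewrite /= /gauss_eval /= mulrN.
apply: (@pancyclic_compl_zero_divisor_graph _ _ f g (p ^ m.-1)%:R%R).
- move=> [a b] [c d]; rewrite !fE !gE => efg egg.
  congr Gauss.
    apply: (mulrI unit2).
    transitivity ((a + b * j) + (a - b * j))%R; first by ring.
    by rewrite efg egg; ring.
  apply: (mulrI unit2j).
  transitivity ((a + b * j) - (a - b * j))%R; first by ring.
  by rewrite efg egg; ring.
- move=> u v.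
  (* Solving a + b j = u and a - b j = v gives a = (u + v) / 2 and b = (u - v) / (2 j), where 1 / j
     = - j. *)
  exists (Gauss (u / 2%:R + v / 2%:R) (- (u / 2%:R - v / 2%:R) * j))%R.
  rewrite fE gE -mulrA jj; split.
    by rewrite -[RHS](divrK unit2); ring.
  by rewrite -[RHS](divrK unit2); ring.
- by move=> s; rewrite unit_Zp_primeX.
(* The exponent 2 (m - 1) is at least m because [1 < m]. *)
- apply/eqP; rewrite -natrM Zp_nat_eq0 // -expnD dvdn_exp2l //; lia.
- exact: unit2.
Qed.
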